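(* Let $\alpha>0$, let $\phi(z)=|z|^\alpha$ on $\mathbb{C}$, let $\rho=\rho_\phi$ be its associated radius function, and let $\Lambda_\phi^P$ be the Poisson process with underlying measure $d\sigma_\phi(z)=\frac{dm(z)}{\rho^2(z)}$. Then $\Lambda_\phi^P$ is almost surely separated if and only if $\alpha<1$.
   Context: $m$ is Lebesgue measure on $\mathbb{C}$ and $D(z,r)$ is the disk with center $z$ and radius $r$. With $\nu=\Delta\phi$ (here $\Delta|z|^\alpha=\alpha^2|z|^{\alpha-2}$), $\rho(z)=\rho_\phi(z)$ denotes the positive radius such that $\nu(D(z,\rho(z)))=1$. The Poisson process $\Lambda_\phi^P$ with underlying measure $\sigma_\phi$ is the point process in $\mathbb{C}$ characterized by: (i) for any Borel set $A\subset\mathbb{C}$, the counting variable $N(A)=\#(A\cap\Lambda_\phi^P)$ has Poisson distribution of parameter $\sigma_\phi(A)$; (ii) for disjoint Borel sets the corresponding counting variables are independent. A sequence $\{\lambda_k\}\subset\mathbb{C}$ is separated if $\inf_{j\ne k}|\lambda_k-\lambda_j|>0$. *)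

(* Defs.v *)
From HB Require Import structures.
From mathcomp Require Import all_boot all_order all_algebra.
From mathcomp Require Import complex.
From mathcomp Require Import all_classical all_reals all_analysis.
From mathcomp Require Import measurable_realfun.
Set Implicit Arguments.
Unset Strict Implicit.
Unset Printing Implicit Defensive.
Import Order.TTheory GRing.Theory Num.Theory.
Import numFieldNormedType.Exports.
Import ComplexField.

Local Open Scope classical_set_scope.
Local Open Scope ring_scope.

Section complex_plane.
Context {R : realType}.

Definition ReIm (z : R[i]) : (measurableTypeR R * measurableTypeR R)%type :=
  (complex.Re z, complex.Im z).

Definition ofReIm (p : measurableTypeR R * measurableTypeR R) : R[i] :=
  (p.1 +i* p.2)%C.

HB.instance Definition _ := isPointed.Build R[i] 0.

(* The Borel sigma-algebra of C is the one transported from R * R. *)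
HB.instance Definition _ :=
  Measurable.copy R[i] (g_sigma_algebra_preimageType ReIm).

Lemma measurable_ofReIm : measurable_fun setT ofReIm.
Proof. move=> _ _ [B mB <-]; rewrite !setTI -comp_preimage.
by rewrite (_ : ReIm \o ofReIm = id) //; apply/funext => -[]. Qed.

Definition lebesgueC : set R[i] -> \bar R :=
  pushforward (@lebesgue_measure R \x @lebesgue_measure R)%E ofReIm.

HB.instance Definition _ := Measure.copy lebesgueC
  (measure_function_pushforward__canonical__measure_function_Measure _ measurable_ofReIm).

(* Normc.normc is the modulus with values in R; the norm `|z| lies in R[i]. *)
Definition disk (z : R[i]) (r : R) : set R[i] :=
  [set w | Normc.normc (w - z) < r].

(* The measure nu = Delta phi for phi(z) = |z| ^ alpha, whose density is
   alpha ^ 2 |z| ^ (alpha - 2); the value of the density at 0 is irrelevant. *)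
Definition laplacian_measure (alpha : R) (A : set R[i]) : \bar R :=
  \int[lebesgueC]_(z in A) (alpha ^+ 2 * Normc.normc z `^ (alpha - 2))%:E.

(* nu (D(z, r)) is strictly increasing in r, so that this determines rho. *)
Definition is_radius_function (nu : set R[i] -> \bar R) (rho : R[i] -> R) :=
  forall z, 0 < rho z /\ nu (disk z (rho z)) = 1%E.

Definition intensity (rho : R[i] -> R) (A : set R[i]) : \bar R :=
  \int[lebesgueC]_(z in A) (rho z ^- 2)%:E.

End complex_plane.

(* A finite or infinite sequence (lambda_k)_(k in labels): points are counted
   with multiplicity, and the values of atom outside labels are irrelevant. *)
Record configuration (T : Type) := Configuration {
  labels : set nat ;
  atom : nat -> T }.

Definition count_points {R : realType} (T : Type) (c : configuration T)
    (A : set T) : \bar R :=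
  counting [set k | labels c k /\ A (atom c k)].

(* The infimum is +oo when there are fewer than two points. *)
Definition is_separated {R : realType} (c : configuration R[i]) : Prop :=
  (0 < ereal_inf [set x : \bar R | exists j k, [/\ labels c j, labels c k,
         j != k & x = (Normc.normc (atom c k - atom c j))%:E]])%E.

Section poisson_process.
Context {R : realType} (d : measure_display) (Omega : measurableType d)
  (P : probability Omega R).
Implicit Types X : Omega -> \bar R.

(* X has the Poisson law with parameter l; for l = +oo this means X = +oo a.s.
   poisson_prob, unlike poisson_pmf, is correct at l = 0 (it is the Dirac mass
   at 0); its second argument is unused. *)
Definition has_poisson_law X (l : \bar R) : Prop :=
  match l with
  | l%:E => forall U : set nat,
      P (X @^-1` [set n%:R%:E | n in U]) = poisson_prob l 0%N U
  | +oo%E => P (X @^-1` [set +oo%E]) = 1%E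
  | -oo%E => False
  end.

(* Taking B i = setT shows that every subfamily satisfies the product rule. *)
Definition mutually_independent (n : nat) (X : 'I_n -> Omega -> \bar R) :=
  forall B : 'I_n -> set (\bar R), (forall i, measurable (B i)) ->
  P (\bigcap_i (X i @^-1` B i)) = (\prod_(i < n) P (X i @^-1` B i))%E.

Record is_poisson_process (d' : measure_display) (T : measurableType d')
    (sigma : set T -> \bar R) (Lambda : Omega -> configuration T) : Prop := {
  poisson_process_measurable : forall A : set T, measurable A ->
    measurable_fun setT (fun w => count_points (Lambda w) A : \bar R) ;
  poisson_process_law : forall A : set T, measurable A ->
    has_poisson_law (fun w => count_points (Lambda w) A) (sigma A) ;
  poisson_process_independent : forall (n : nat) (A : 'I_n -> set T),
    (forall i, measurable (A i)) -> trivIset setT A ->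
    mutually_independent (fun i w => count_points (Lambda w) (A i)) }.

End poisson_process.

(* Main.v *)
Require Import Defs.
From HB Require Import structures.
From mathcomp Require Import all_boot all_order all_algebra.
From mathcomp Require Import complex finmap.
From mathcomp Require Import all_classical all_reals all_analysis.
From mathcomp Require Import measurable_realfun.
From mathcomp Require Import ring lra zify.
From Stdlib Require PeanoNat.
Import Order.TTheory GRing.Theory Num.Theory.
Import numFieldNormedType.Exports.

Set Implicit Arguments.
Unset Strict Implicit.
Unset Printing Implicit Defensive.

Local Open Scope classical_set_scope.
Local Open Scope ring_scope.

(** Around [z] the density of [nu] is [alpha ^ 2 |z| ^ (alpha - 2)], so a disk of
    mass [1] centered at [z] has radius of order [|z| ^ (1 - alpha / 2)]: the
    intensity of the Poisson process is of order [|z| ^ (alpha - 2)]. A Poisson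
    variable of small parameter [l] exceeds [1] with probability of order [l ^ 2],
    so everything is decided by the sum of the squares of the intensities of the
    cells of a grid of mesh [h].

    If [alpha < 1], the dyadic shell [|z| ~ 2 ^ t] consists of about [4 ^ t / h ^ 2]
    cells of intensity about [h ^ 2 * 2 ^ (t (alpha - 2))]; the squares add up to
    [h ^ 2] times a geometric series of ratio [2 ^ (2 alpha - 2) < 1]. Hence the
    probability that two points lie at distance less than [h] is [O(h ^ 2)], and
    letting [h] tend to [0] gives [ae_separated]. The upper bound on the intensity
    is [inv_radius_sqr_le].

    If [alpha >= 1], then [rho z ^ 2 <= 16 |z|] away from the origin
    ([radius_sqr_le]). For every [h], disjoint boxes of side [h] placed at the
    integer points of a planar sector, enumerated by increasing distance, have
    intensities at least of order [h ^ 2 / sqrt m]. The squares dominate a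
    multiple of the harmonic series, and by independence almost surely some box
    contains two points ([negligible_few_sector]). So almost surely there are
    pairs of points at arbitrarily small distance.

    The function [rho] is only known through its defining property, so that
    intensities are compared by a monotonicity of the integral that holds for
    arbitrary nonnegative functions ([le_integral_nonneg]). *)

(** * Integrals of nonnegative functions, not necessarily measurable *)

(** The integral of a nonnegative function is a supremum over the simple
    functions below it. *)
Lemma le_integral_nonneg d (T : measurableType d) (R : realType)
    (mu : {measure set T -> \bar R}) (D : set T) (f g : T -> \bar R) :
  (forall x, D x -> 0 <= f x)%E -> (forall x, D x -> f x <= g x)%E ->
  (\int[mu]_(x in D) f x <= \int[mu]_(x in D) g x)%E.
Proof.
move=> f0 fg.
have g0 x : D x -> (0 <= g x)%E by move=> Dx; apply: le_trans (f0 _ Dx) (fg _ Dx).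
rewrite !ge0_integralE//; apply: ge_ereal_sup => _ [h /= hf <-].
apply: ereal_sup_ubound; exists h => //= x.
apply: le_trans (hf x) _; rewrite /patch; case: ifPn => // /set_mem; exact: fg.
Qed.

Lemma integral_le_cst d (T : measurableType d) (R : realType)
    (mu : {measure set T -> \bar R}) (D : set T) (f : T -> \bar R) (K : R) :
  measurable D -> (forall x, D x -> 0 <= f x <= K%:E)%E ->
  (\int[mu]_(x in D) f x <= K%:E * mu D)%E.
Proof.
move=> mD fK; rewrite -integral_cst//.
by apply: le_integral_nonneg => x /fK/andP[].
Qed.

Lemma integral_ge_cst d (T : measurableType d) (R : realType)
    (mu : {measure set T -> \bar R}) (D : set T) (f : T -> \bar R) (K : R) :
  measurable D -> 0 <= K -> (forall x, D x -> K%:E <= f x)%E ->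
  (K%:E * mu D <= \int[mu]_(x in D) f x)%E.
Proof.
move=> mD K0 fK; rewrite -integral_cst//.
by apply: le_integral_nonneg => // x _; rewrite lee_fin.
Qed.

(** * The complex plane *)

Section plane.
Context {R : realType}.
Implicit Types (z w : R[i]) (x y r h : R).

Lemma measurable_sqrt : measurable_fun setT (@Num.sqrt R).
Proof. by apply: continuous_measurable_fun; exact: sqrt_continuous. Qed.

Lemma measurable_ReIm : measurable_fun setT (@ReIm R).
Proof. by move=> _ B mB; exists B. Qed.

Lemma measurable_Re : measurable_fun setT (@complex.Re R).
Proof. exact: (measurableT_comp measurable_fst measurable_ReIm). Qed.

Lemma measurable_Im : measurable_fun setT (@complex.Im R).
Proof. exact: (measurableT_comp measurable_snd measurable_ReIm). Qed.

Lemma normcE z : Normc.normc z = Num.sqrt (complex.Re z ^+ 2 + complex.Im z ^+ 2).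
Proof. by case: z. Qed.

Lemma normc_ge0 z : 0 <= Normc.normc z.
Proof. by rewrite normcE sqrtr_ge0. Qed.

Lemma sqr_normc z : Normc.normc z ^+ 2 = complex.Re z ^+ 2 + complex.Im z ^+ 2.
Proof. by rewrite normcE sqr_sqrtr// addr_ge0// sqr_ge0. Qed.

Lemma normc_triangle z w : Normc.normc z <= Normc.normc w + Normc.normc (z - w).
Proof.
have := @le_normcD R w (z - w).
by rewrite addrC subrK.
Qed.

Lemma normc_sym z w : Normc.normc (z - w) = Normc.normc (w - z).
Proof. by rewrite -opprB normcN. Qed.

Lemma abs_Re_le z : `|complex.Re z| <= Normc.normc z.
Proof.
by rewrite normcE -sqrtr_sqr ler_wsqrtr// lerDl sqr_ge0.
Qed.

Lemma abs_Im_le z : `|complex.Im z| <= Normc.normc z.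
Proof.
by rewrite normcE -sqrtr_sqr ler_wsqrtr// lerDr sqr_ge0.
Qed.

Lemma normc_lt z r : 0 < r ->
  (Normc.normc z < r) = (complex.Re z ^+ 2 + complex.Im z ^+ 2 < r ^+ 2).
Proof.
by move=> r0; rewrite -sqr_normc ltr_pXn2r// nnegrE ?normc_ge0// ltW.
Qed.

Lemma measurable_normc : measurable_fun setT (@Normc.normc R).
Proof.
rewrite (_ : @Normc.normc R = fun z => Num.sqrt (complex.Re z ^+ 2 + complex.Im z ^+ 2));
  last by apply/funext => z; rewrite normcE.
apply: (measurableT_comp measurable_sqrt).
by apply: measurable_funD; apply: measurable_funX; [exact: measurable_Re|exact: measurable_Im].
Qed.

Lemma measurable_normc_sub z : measurable_fun setT (fun w => Normc.normc (w - z)).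
Proof.
rewrite (_ : (fun w => _) = fun w => Num.sqrt ((complex.Re w - complex.Re z) ^+ 2
    + (complex.Im w - complex.Im z) ^+ 2)); last first.
  by apply/funext => w; rewrite normcE; case: w z => [a b] [c d].
apply: (measurableT_comp measurable_sqrt).
by apply: measurable_funD; apply: measurable_funX; apply: measurable_funB => //;
  [exact: measurable_Re|exact: measurable_Im].
Qed.

Lemma measurable_disk z r : measurable (disk z r).
Proof.
rewrite /disk -[X in measurable X]setTI.
by apply: measurable_fun_ltr => //; exact: measurable_normc_sub.
Qed.

(** Half-open, so that the translates by multiples of [h] tile the plane. *)
Definition box x y h : set R[i] :=
  [set w | x <= complex.Re w < x + h /\ y <= complex.Im w < y + h].

Lemma box_preimage x y h :
  box x y h = @complex.Re R @^-1` `[x, x + h[ `&` @complex.Im R @^-1` `[y, y + h[.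
Proof. by apply/seteqP; split=> w /=; rewrite !in_itv. Qed.

Lemma measurable_box x y h : measurable (box x y h).
Proof.
rewrite box_preimage; apply: measurableI; rewrite -[X in measurable X]setTI.
- exact: measurable_Re.
- exact: measurable_Im.
Qed.

Lemma lebesgueC_box x y h : 0 <= h -> lebesgueC (box x y h) = (h ^+ 2)%:E.
Proof.
move=> h0; rewrite /lebesgueC /pushforward.
rewrite (_ : ofReIm @^-1` _ = `[x, x + h[%classic `*` `[y, y + h[%classic); last first.
  by apply/seteqP; split=> -[a b] /=; rewrite !in_itv.
rewrite product_measure1E//.
have itvE (a : R) : lebesgue_measure (`[a, a + h[%classic : set R) = h%:E.
  rewrite lebesgue_measure_itv/= lte_fin ltrDl -EFinB addrAC subrr add0r.
  by case: ltP => // hle0; rewrite (@le_anti _ _ h 0) ?h0 ?hle0.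
by rewrite (_ : h ^+ 2 = h * h)// EFinM; congr (_ * _)%E; exact: itvE.
Qed.

End plane.

(** * Bounds on the radius function *)

Section radius.
Context {R : realType}.
Implicit Types (z w : R[i]) (alpha x y r t : R).

Lemma le0_ger_powR r x y : r <= 0 -> 0 < x -> x <= y -> y `^ r <= x `^ r.
Proof.
move=> r0 x0 xy; rewrite -[r]opprK powRN [leRHS]powRN lef_pV2 ?posrE ?powR_gt0//.
  by rewrite ge0_ler_powR ?oppr_ge0// nnegrE; lra.
by lra.
Qed.

Lemma powR_oppM x r : 0 < x -> x `^ r * x `^ (- r) = 1.
Proof. by move=> x0; rewrite powRN divff// gt_eqF// powR_gt0. Qed.

Section laplacian.
Variable alpha : R.
Let density z : \bar R := (alpha ^+ 2 * Normc.normc z `^ (alpha - 2))%:E.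

Lemma density_ge0 z : (0 <= density z)%E.
Proof. by rewrite lee_fin mulr_ge0 ?sqr_ge0 ?powR_ge0. Qed.

Lemma measurable_density : measurable_fun setT density.
Proof.
apply/measurable_EFinP; apply: measurable_funM => //.
exact: (measurableT_comp (measurable_powR _) measurable_normc).
Qed.

Lemma le_laplacian_measure (A B : set R[i]) : measurable A -> measurable B ->
  A `<=` B -> (laplacian_measure alpha A <= laplacian_measure alpha B)%E.
Proof.
move=> mA mB AB; apply: ge0_subset_integral => //.
- by apply: measurable_funTS; exact: measurable_density.
- by move=> z _; exact: density_ge0.
Qed.

Lemma laplacian_measureU (A B : set R[i]) : measurable A -> measurable B ->
  [disjoint A & B] -> laplacian_measure alpha (A `|` B) =
  (laplacian_measure alpha A + laplacian_measure alpha B)%E.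
Proof.
move=> mA mB AB; apply: ge0_integral_setU => //.
- by apply: measurable_funTS; exact: measurable_density.
- by move=> z _; exact: density_ge0.
Qed.

(** Since [alpha <= 2] the density is nonincreasing in the modulus, which is at
    least [|z| / 2] on the disk; the disk is contained in a square of side
    [2 r]. *)
Lemma laplacian_measure_disk_le z r : 0 < r -> r <= Normc.normc z / 2 ->
  alpha <= 2 ->
  (laplacian_measure alpha (disk z r) <=
   (alpha ^+ 2 * (Normc.normc z / 2) `^ (alpha - 2) * (4 * r ^+ 2))%:E)%E.
Proof.
move=> r0 rz a2.
apply: le_trans (integral_le_cst (K := alpha ^+ 2 * (Normc.normc z / 2) `^ (alpha - 2))
  _ (measurable_disk z r) _) _.
  move=> w; rewrite /disk/= => wz; rewrite density_ge0/= lee_fin ler_wpM2l ?sqr_ge0//.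
  have := normc_triangle z w; rewrite normc_sym => zw.
  by apply: le0_ger_powR; lra.
rewrite [leRHS]EFinM lee_wpmul2l ?lee_fin 1?mulr_ge0 ?sqr_ge0 ?powR_ge0//.
apply: (@le_trans _ _ (lebesgueC (box (complex.Re z - r) (complex.Im z - r) (2 * r)))).
  apply: le_measure; rewrite ?inE; [exact: measurable_disk|exact: measurable_box|].
  move=> w; rewrite /disk /box/= => wz.
  have := abs_Re_le (w - z); have := abs_Im_le (w - z).
  case: w z wz {rz} => [a b] [c d] /= wz; rewrite !ler_norml => /andP[? ?] /andP[? ?].
  by split; apply/andP; split; lra.
by rewrite lebesgueC_box ?lee_fin; lra.
Qed.

Lemma laplacian_measure_box_ge x y r c : 0 <= r -> 0 <= c ->
  (forall w, box x y r w -> c <= alpha ^+ 2 * Normc.normc w `^ (alpha - 2)) ->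
  ((c * r ^+ 2)%:E <= laplacian_measure alpha (box x y r))%E.
Proof.
move=> r0 c0 cP; rewrite EFinM -(lebesgueC_box x y r0).
apply: integral_ge_cst => //; first exact: measurable_box.
Qed.

Variable rho : R[i] -> R.
Hypothesis rhoP : is_radius_function (laplacian_measure alpha) rho.

Lemma disk_sub z r r' : r <= r' -> disk z r `<=` disk z r'.
Proof. by move=> rr' w; rewrite /disk/= => /lt_le_trans; exact. Qed.

Lemma lt_radius z r : (laplacian_measure alpha (disk z r) < 1)%E -> r < rho z.
Proof.
move=> nu1; rewrite ltNge; apply/negP => /(disk_sub (z := z)) sub.
have [_ nuz] := rhoP z; move: nu1; apply/negP; rewrite -leNgt -nuz.
by apply: le_laplacian_measure => //; exact: measurable_disk.
Qed.

Lemma ge_radius z r : (1 < laplacian_measure alpha (disk z r))%E -> rho z <= r.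
Proof.
move=> nu1; rewrite leNgt; apply/negP => /ltW/(disk_sub (z := z)) sub.
have [_ nuz] := rhoP z; move: nu1; apply/negP; rewrite -leNgt -nuz.
by apply: le_laplacian_measure => //; exact: measurable_disk.
Qed.

End laplacian.

Section bounds.
Variables (alpha : R) (rho : R[i] -> R).
Hypothesis rhoP : is_radius_function (laplacian_measure alpha) rho.

(** In a disk of radius at most half the distance to the origin the density is
    comparable to its value at the center, so that [rho z] is at least of order
    [|z| ^ (1 - alpha / 2)]. *)
Lemma radius_sqr_ge z : 0 < alpha < 1 -> 2 <= Normc.normc z ->
  (Normc.normc z / 2) `^ (2 - alpha) / 4 <= rho z ^+ 2.
Proof.
move=> /andP[a0 a1] z2; set t := Normc.normc z / 2.
have t1 : 1 <= t by rewrite /t; lra.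
have t0 : 0 < t by lra.
have p0 : 0 < t `^ (2 - alpha) by rewrite powR_gt0.
set r := Num.sqrt (t `^ (2 - alpha) / 4).
have r2 : r ^+ 2 = t `^ (2 - alpha) / 4 by rewrite sqr_sqrtr//; lra.
have r0 : 0 < r by rewrite sqrtr_gt0; lra.
have rt : r <= t.
  rewrite -(@ler_pXn2r _ 2)// ?nnegrE; [|lra|lra].
  rewrite r2; have : t `^ (2 - alpha) <= t `^ 2 by apply: ler_powR => //; lra.
  by rewrite (powR_mulrn _ (ltW t0)) => h; lra.
have rho_r : r < rho z.
  apply: (lt_radius rhoP).
  apply: le_lt_trans (laplacian_measure_disk_le _ _ _) _ => //; first by lra.
  rewrite lte_fin r2 -/t.
  have := powR_oppM (alpha - 2) t0; rewrite opprB => e.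
  have -> : alpha ^+ 2 * t `^ (alpha - 2) * (4 * (t `^ (2 - alpha) / 4)) =
    alpha ^+ 2 * (t `^ (alpha - 2) * t `^ (2 - alpha)) by field.
  by rewrite e; nra.
by rewrite -r2 ler_pXn2r// ?nnegrE; lra.
Qed.

(** The density may be singular at the origin. There the bound comes from the
    positive mass of an annulus of [disk 0 (rho 0)], which makes the mass of
    [disk 0 (rho 0 / 2)] smaller than 1. *)
Lemma radius_ge_near0 : 0 < alpha < 1 ->
  exists2 r1, 0 < r1 & forall z, Normc.normc z < 2 -> r1 <= rho z.
Proof.
move=> /andP[a0 a1]; have [R0 nu0] := rhoP 0; set r0 := rho 0 in R0 nu0.
have half : (laplacian_measure alpha (disk 0%R (r0 / 2)) < 1)%E.
  (* Q lies in the annulus: its corners have moduli between r0 / 2 and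
     r0 * sqrt 26 / 8. *)
  pose Q : set R[i] := box (r0 / 2) 0 (r0 / 8).
  have mQ : measurable Q by exact: measurable_box.
  have Qn w : Q w -> r0 / 2 <= Normc.normc w < r0.
    move=> [/andP[? ?] /andP[? ?]]; rewrite (normc_lt _ R0).
    by have := abs_Re_le w; rewrite ger0_norm; [move=> ?; apply/andP; split; nra|lra].
  have QP : (0 < laplacian_measure alpha Q)%E.
    apply: lt_le_trans (laplacian_measure_box_ge (c := alpha ^+ 2 * r0 `^ (alpha - 2))
       _ _ _); rewrite ?lte_fin.
    - by rewrite !mulr_gt0 ?powR_gt0//; lra.
    - by lra.
    - by rewrite mulr_ge0 ?sqr_ge0 ?powR_ge0.
    - move=> w /Qn/andP[w1 w2]; rewrite ler_wpM2l ?sqr_ge0//.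
      by apply: le0_ger_powR; lra.
  have : (laplacian_measure alpha (disk 0%R (r0 / 2) `|` Q) <= 1)%E.
    rewrite -nu0; apply: le_laplacian_measure.
    - by apply: measurableU => //; exact: measurable_disk.
    - exact: measurable_disk.
    - move=> w [|/Qn/andP[_]]; rewrite /disk/= ?subr0//; lra.
  rewrite laplacian_measureU//; last 2 first.
  - exact: measurable_disk.
  - rewrite disj_set2E; apply/eqP/seteqP; split=> // w [] /[swap] /Qn/andP[+ _].
    by rewrite /disk/= subr0; lra.
  apply: lt_le_trans; rewrite lteDl//.
  rewrite ge0_fin_numE; last by apply: integral_ge0 => w _; exact: density_ge0.
  apply: (@le_lt_trans _ _ (laplacian_measure alpha (disk 0%R r0))); last by rewrite nu0 ltry.
  apply: le_laplacian_measure; [exact: measurable_disk|exact: measurable_disk|].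
  by apply: disk_sub; lra.
(* Below t0 the disk lies in disk 0 (r0 / 2); above, the density is bounded. *)
pose t0 := r0 / 8; have t0P : 0 < t0 by rewrite /t0; lra.
have p0 : 0 < t0 `^ (2 - alpha) by rewrite powR_gt0.
set s := Num.sqrt (t0 `^ (2 - alpha) / 4).
have s2 : s ^+ 2 = t0 `^ (2 - alpha) / 4 by rewrite sqr_sqrtr//; lra.
have s0 : 0 < s by rewrite sqrtr_gt0; lra.
exists (Num.min t0 s); first by rewrite lt_min t0P.
move=> z z2; apply/ltW/(lt_radius rhoP).
have [zt|zt] := ltP (Normc.normc z / 2) t0.
  apply: le_lt_trans half; apply: le_laplacian_measure; [exact: measurable_disk..|].
  move=> w; rewrite /disk/= lt_min subr0 => /andP[wt _].
  by have := normc_triangle w z; rewrite /t0 in wt zt; lra.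
have m0 : 0 < Num.min t0 s by rewrite lt_min t0P.
have mt : Num.min t0 s <= t0 by rewrite ge_min lexx.
have ms : Num.min t0 s <= s by rewrite ge_min lexx orbT.
apply: le_lt_trans (laplacian_measure_disk_le _ _ _) _ => //; [lra|lra|].
rewrite lte_fin.
have := powR_oppM (alpha - 2) t0P; rewrite opprB => e.
have le1 : (Normc.normc z / 2) `^ (alpha - 2) <= t0 `^ (alpha - 2).
  by apply: le0_ger_powR; lra.
have le2 : (Num.min t0 s) ^+ 2 <= t0 `^ (2 - alpha) / 4.
  by rewrite -s2 ler_pXn2r// ?nnegrE; lra.
apply: (@le_lt_trans _ _ (alpha ^+ 2 * t0 `^ (alpha - 2) * t0 `^ (2 - alpha))).
  apply: ler_pM; rewrite 1?mulr_ge0 ?sqr_ge0 ?powR_ge0//; last by lra.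
  by rewrite ler_wpM2l ?sqr_ge0.
by rewrite -mulrA e; nra.
Qed.

Lemma inv_radius_sqr_le : 0 < alpha < 1 ->
  exists2 K, 0 < K & forall z,
    rho z ^- 2 <= K * (1 + Normc.normc z) `^ (alpha - 2).
Proof.
move=> a01; have [a0 a1] := andP a01.
have [r1 r10 r1P] := radius_ge_near0 a01.
(* 4 serves |z| >= 2, where |z| / 2 >= (1 + |z|) / 3, and r1 ^- 2 serves |z| < 2,
   where the power of (1 + |z|) / 3 <= 1 is at least 1. *)
set M := 4 + r1 ^- 2.
have M4 : 4 <= M by rewrite lerDl invr_ge0 exprn_ge0// ltW.
have M0 : 0 < M by lra.
exists (M * 3 `^ (2 - alpha)); first by rewrite mulr_gt0 ?powR_gt0.
move=> z; have z0 := normc_ge0 z; set n := Normc.normc z in z0 *.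
have -> : M * 3 `^ (2 - alpha) * (1 + n) `^ (alpha - 2) = M * ((1 + n) / 3) `^ (alpha - 2).
  rewrite powRM; [|lra|lra]; rewrite -[3^-1]powR_inv1// -powRrM.
  by rewrite (_ : -1 * (alpha - 2) = 2 - alpha); [ring|lra].
have rho2 : 0 < rho z ^+ 2 by rewrite exprn_gt0//; have [] := rhoP z.
have [zn|zn] := ltP n 2.
  apply: (@le_trans _ _ (M * 1)); last first.
    rewrite ler_wpM2l//; first by lra.
    rewrite -[leLHS](@powRr0 _ ((1 + n) / 3)).
    by apply: ger_powR; [apply/andP; split; lra|lra].
  rewrite mulr1; apply: (@le_trans _ _ (r1 ^- 2)); last by rewrite lerDr.
  rewrite lef_pV2 ?posrE//; last by rewrite exprn_gt0.
  by have := r1P _ zn => h; rewrite ler_pXn2r// ?nnegrE; lra.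
have h := radius_sqr_ge a01 zn; rewrite -/n in h.
have p0 : 0 < (n / 2) `^ (2 - alpha) by rewrite powR_gt0//; lra.
apply: (@le_trans _ _ (4 * (n / 2) `^ (alpha - 2))).
  rewrite (_ : 4 * _ = ((n / 2) `^ (2 - alpha) / 4)^-1).
    by rewrite lef_pV2 ?posrE//; lra.
  by rewrite invfM invrK mulrC -powRN opprB.
apply: ler_pM => //; first exact: powR_ge0.
by apply: le0_ger_powR; lra.
Qed.

(** Comparing the density with [1 / |w|], which it dominates away from the unit
    disk as soon as [alpha >= 1]. *)
Lemma radius_sqr_le z : 1 <= alpha -> 64 <= Normc.normc z ->
  rho z ^+ 2 <= 16 * Normc.normc z.
Proof.
move=> a1; set n := Normc.normc z => n64.
set r := Num.sqrt (16 * n).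
have r2 : r ^+ 2 = 16 * n by rewrite sqr_sqrtr//; lra.
have r0 : 0 < r by rewrite sqrtr_gt0; lra.
have rn : r <= n / 2.
  by rewrite -(@ler_pXn2r _ 2)// ?nnegrE; [rewrite r2; nra|lra|lra].
have : rho z <= r.
  apply: (ge_radius rhoP).
  pose Q : set R[i] := box (complex.Re z - r / 2) (complex.Im z - r / 2) r.
  have Qz w : Q w -> Normc.normc (w - z) < r.
    rewrite (normc_lt _ r0) => -[/andP[? ?] /andP[? ?]].
    have -> : complex.Re (w - z) = complex.Re w - complex.Re z by case: (w) (z) => [? ?] [].
    have -> : complex.Im (w - z) = complex.Im w - complex.Im z by case: (w) (z) => [? ?] [].
    by nra.
  apply: (@lt_le_trans _ _ (laplacian_measure alpha Q)); last first.
    by apply: le_laplacian_measure;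
      [exact: measurable_box|exact: measurable_disk|exact: Qz].
  apply: lt_le_trans (laplacian_measure_box_ge (c := 2 / 3 / n) _ _ _).
  - rewrite lte_fin r2 (_ : 2 / 3 / n * (16 * n) = 32 / 3); first by lra.
    by field; lra.
  - exact: ltW.
  - by rewrite divr_ge0//; lra.
  move=> w /Qz wz.
  have := normc_triangle z w; have := normc_triangle w z.
  rewrite (normc_sym z w) -/n => h1 h2.
  set m := Normc.normc w in h1 h2 *.
  have m1 : 1 <= m by lra.
  apply: (@le_trans _ _ (m `^ (-1))).
    rewrite powR_inv1; last by lra.
    by rewrite ler_pdivrMr; [rewrite [leRHS]mulrC ler_pdivlMr; lra|lra].
  apply: (@le_trans _ _ (1 * m `^ (alpha - 2))).
    by rewrite mul1r; apply: ler_powR => //; lra.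
  by rewrite ler_wpM2r ?powR_ge0//; nra.
by move=> h; rewrite -r2 ler_pXn2r// ?nnegrE; have [] := rhoP z; lra.
Qed.

End bounds.
End radius.

(** * Boxes with at most one point *)

Section poisson.
Context {R : realType}.

Lemma poisson_prob01 (l : R) : 0 <= l ->
  poisson_prob l 0%N [set 0; 1]%N = ((1 + l) * expR (- l))%:E.
Proof.
rewrite /poisson_prob le_eqVlt => /predU1P[<-|l0].
  by rewrite ltxx diracE mem_set ?oppr0 ?expR0 ?addr0 ?mulr1//; left.
rewrite l0 esum_fset; last 2 first.
- exact: finite_set2.
- by move=> k _; rewrite lee_fin poisson_pmf_ge0.
rewrite fsbigU0; [|exact: finite_set1|exact: finite_set1|by move=> k [/= ->]].
rewrite !fsbig_set1 /poisson_pmf l0 /= -EFinD; congr EFin.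
by rewrite expr0 expr1 !divr1 -mulrDl.
Qed.

(** The two-term Taylor bound comes from [expR s = expR (s / 2) ^+ 2]; the
    constant [3] is what it leaves of the optimal one. *)
Lemma poisson01_le (l s : R) : 0 <= l <= 1 -> l <= s ->
  (1 + s) * expR (- s) <= 1 - (l / 3) ^+ 2.
Proof.
move=> /andP[l0 l1] ls; rewrite expRN -ler_pdivlMr ?invr_gt0 ?expR_gt0// invrK.
have h : (1 + s / 2) ^+ 2 <= expR s.
  rewrite [in leRHS](_ : s = s / 2 + s / 2) ?expRD; last by field.
  rewrite -[leRHS]expr2 ler_pXn2r// ?nnegrE ?expR_ge0//; first exact: expR_ge1Dx.
  by lra.
apply: (@le_trans _ _ ((1 - (l / 3) ^+ 2) * (1 + s / 2) ^+ 2)); last first.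
  by rewrite ler_wpM2l//; nra.
have l2 : l ^+ 2 <= s ^+ 2 by rewrite ler_pXn2r// nnegrE; lra.
have l2l : l ^+ 2 <= l by nra.
have s0 : 0 <= s by lra.
have l2s : l ^+ 2 * s <= s ^+ 2.
  by apply: (@le_trans _ _ (l * s)); [rewrite ler_wpM2r|rewrite expr2 ler_wpM2r].
have l2s2 : l ^+ 2 * s ^+ 2 <= s ^+ 2.
  by rewrite ler_piMl ?sqr_ge0//; lra.
by rewrite -subr_ge0 [X in 0 <= X](_ : _ = (s ^+ 2 / 4 - l ^+ 2 / 9 - l ^+ 2 * s / 9
  - l ^+ 2 * s ^+ 2 / 36)); [lra|field].
Qed.

Lemma poisson01_ge (s : R) : 0 <= s -> 1 - s ^+ 2 <= (1 + s) * expR (- s).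
Proof.
move=> s0; have := expR_ge1Dx (- s) => h.
by apply: le_trans (ler_wpM2l _ h); [nra|lra].
Qed.

(** Stated on labels, so that coinciding points count separately. *)
Definition at_most_one T (c : configuration T) (A : set T) :=
  forall j k, labels c j -> labels c k -> A (atom c j) -> A (atom c k) -> j = k.

(** This identifies an event on the values of the counting variable, to which the
    law and the independence apply, with a property of pairs of labels. *)
Lemma count_points01 T (c : configuration T) (A : set T) :
  [set n%:R%:E | n in [set 0; 1]%N] (count_points c A : \bar R) <->
  at_most_one c A.
Proof.
rewrite /count_points /counting; set S := [set k | _].
have [fS|nfS] := asboolP (finite_set S); last first.
  split; first by move=> [n _].
  move=> one; exfalso; apply: nfS.
  have [->//|/set0P[j Sj]] := eqVneq S set0.
  apply: (@sub_finite_set _ _ [set j]) => // k Sk /=.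
  by apply: one; [exact: Sk.1|exact: Sj.1|exact: Sk.2|exact: Sj.2].
split.
  move=> [n n01 /= [/eqP]]; rewrite eqr_nat => /eqP cardS j k cj ck Aj Ak.
  have Sj : j \in fset_set S by rewrite in_fset_set// inE.
  have Sk : k \in fset_set S by rewrite in_fset_set// inE.
  apply: contrapT => /eqP jk.
  have : ([fset j; k] `<=` fset_set S)%fset.
    by apply/fsubsetP => i; rewrite !inE => /orP[] /eqP ->.
  move=> /fsubset_leq_card; rewrite cardfs2 jk -cardS.
  by case: n01 => /= ->.
move=> one; have [->|/set0P[j Sj]] := eqVneq S set0.
  by exists 0%N; [left|rewrite fset_set0 cardfs0].
exists 1%N; first by right.
have -> : S = [set j].
  apply/seteqP; split=> [k Sk /=|_ ->//].
  by apply: one; [exact: Sk.1|exact: Sj.1|exact: Sk.2|exact: Sj.2].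
by rewrite fset_set1 cardfs1.
Qed.

Section process.
Context (d : measure_display) (Omega : measurableType d) (P : probability Omega R)
  (d' : measure_display) (T : measurableType d') (sigma : set T -> \bar R)
  (Lambda : Omega -> configuration T).
Hypothesis LambdaP : is_poisson_process P sigma Lambda.
Hypothesis sigma_ge0 : forall A, (0 <= sigma A)%E.

Definition few (A : set T) : set Omega := [set w | at_most_one (Lambda w) A].

Let target : set (\bar R) := [set n%:R%:E | n in [set 0; 1]%N].

Lemma fewE A : few A = (fun w => count_points (Lambda w) A) @^-1` target.
Proof.
by apply/seteqP; split=> w /=; [move/(count_points01 (Lambda w) A).2|move/(count_points01 (Lambda w) A).1].
Qed.

Lemma measurable_target : measurable target.
Proof.
rewrite (_ : target = [set 0%:E] `|` [set 1%:E]).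
  by apply: measurableU; exact: emeasurable_set1.
apply/seteqP; split=> x /=.
  by move=> [n [/=->|/=->] <-]; [left|right].
by move=> [->|->]; [exists 0%N => //; left|exists 1%N => //; right].
Qed.

Lemma measurable_few A : measurable A -> measurable (few A).
Proof.
move=> mA; rewrite fewE -[X in measurable X]setTI.
by apply: (poisson_process_measurable LambdaP) => //; exact: measurable_target.
Qed.

Lemma probability_few A s : measurable A -> sigma A = s%:E ->
  P (few A) = ((1 + s) * expR (- s))%:E.
Proof.
move=> mA sA; have := poisson_process_law LambdaP mA; rewrite /has_poisson_law sA.
move=> /(_ [set 0; 1]%N); rewrite poisson_prob01 ?fewE//.
by rewrite -lee_fin -sA.
Qed.

(** [sigma A] may be infinite, and then [A] contains infinitely many points
    almost surely. *)
Lemma probability_few_le A l : measurable A -> 0 <= l <= 1 ->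
  (l%:E <= sigma A)%E -> (P (few A) <= (1 - (l / 3) ^+ 2)%:E)%E.
Proof.
move=> mA l01; case sA : (sigma A) => [s| |] // ls.
  by rewrite (probability_few mA sA) lee_fin poisson01_le.
have := poisson_process_law LambdaP mA; rewrite /has_poisson_law sA => PX.
set X := (X in P X = _) in PX.
have mX : measurable X.
  rewrite /X -[X in measurable X]setTI.
  by apply: (poisson_process_measurable LambdaP) => //; exact: emeasurable_set1.
apply: (@le_trans _ _ (P (~` X))).
  apply: le_measure; rewrite ?inE; [exact: measurable_few|exact: measurableC|].
  by move=> w; rewrite fewE /X/= => -[n _ <-].
by rewrite probability_setC// PX subee// lee_fin; nra.
Qed.

Lemma probability_many_le A l : measurable A -> (sigma A <= l%:E)%E ->
  (P (~` few A) <= (l ^+ 2)%:E)%E.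
Proof.
move=> mA; case sA : (sigma A) => [s| |] //; last first.
  by move=> _; have := sigma_ge0 A; rewrite sA.
rewrite lee_fin => sl.
have s0 : 0 <= s by rewrite -lee_fin -sA.
rewrite probability_setC ?(probability_few mA sA); last exact: measurable_few.
rewrite -EFinB lee_fin; have := poisson01_ge s0 => h.
by nra.
Qed.

Lemma probability_bigcap_few (n : nat) (A : 'I_n -> set T) :
  (forall i, measurable (A i)) -> trivIset setT A ->
  P (\bigcap_i few (A i)) = (\prod_(i < n) P (few (A i)))%E.
Proof.
move=> mA tA; have := poisson_process_independent LambdaP mA tA.
move=> /(_ (fun=> target) (fun=> measurable_target)).
rewrite (eq_bigcapr (fun i _ => fewE (A i))) => ->.
by apply: eq_bigr => i _; rewrite fewE.
Qed.

End process.
End poisson.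

(** * Separation for [alpha < 1] *)

Section sparse.
Context {R : realType}.

(** Two reals at distance less than [h] lie in a common interval of length [2 h]
    with left end on the grid of mesh [h]: the one that starts at the last grid
    point before the smaller of them. *)
Lemma exists_common_cell (a b h L : R) : 0 < h -> `|a - b| < h ->
  - L <= a < L -> - L <= b < L -> exists i : nat, i%:R * h < 2 * L /\
  (- L + i%:R * h <= a < - L + i%:R * h + 2 * h) /\
  (- L + i%:R * h <= b < - L + i%:R * h + 2 * h).
Proof.
move=> h0; wlog ab : a b / a <= b => [th|].
  have [/th//|/ltW ba abh aL bL] := leP a b.
  by have [||||i [? [? ?]]] := th b a => //; [rewrite distrC|exists i].
rewrite ler0_norm ?subr_le0// opprB => bah /andP[La aL] /andP[Lb bL].
exists (Num.truncn ((a + L) / h)).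
have q0 : 0 <= (a + L) / h by rewrite divr_ge0//; lra.
have /andP[] := truncn_itv q0; set i := Num.truncn _.
rewrite ler_pdivlMr// ltr_pdivrMr// -natr1 mulrDl mul1r => il ir.
by split; [lra|split; apply/andP; split; lra].
Qed.

Lemma exists_dyadic_shell (x : R) : 1 <= x -> exists t, 2 ^+ t <= x < 2 ^+ t.+1.
Proof.
move=> x1; have x0 : 0 <= x by lra.
set m := Num.truncn x; have /andP[mx xm] := truncn_itv x0; rewrite -/m in mx xm.
have m0 : (0 < m)%N by rewrite truncn_gt0.
exists (trunc_log 2 m); apply/andP; split.
  by apply: le_trans mx; rewrite -natrX ler_nat trunc_logP.
by apply: lt_le_trans xm _; rewrite -natrX ler_nat trunc_log_ltn.
Qed.

Lemma not_separated_close_pair (c : configuration R[i]) (h : R) : 0 < h ->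
  ~ is_separated c -> exists j k, [/\ labels c j, labels c k, j != k &
    Normc.normc (atom c k - atom c j) < h].
Proof.
move=> h0; rewrite /is_separated => /negP; rewrite -leNgt => inf0.
have infh : (ereal_inf _ < h%:E)%E := le_lt_trans inf0 (h0 : (0 < h%:E)%E).
have [_ [j [k [cj ck jk ->]]] kjh] := ereal_inf_lt infh.
by exists j, k; split; rewrite // -lte_fin.
Qed.

(** The square [box] of side [2 h] with corner at the grid point of indices
    [i], [j], minus a disk about the origin. For [h <= 1 / 2], every pair of
    points at distance less than [h], one of which satisfies
    [2 ^ t <= 1 + |z| < 2 ^ t.+1], lies in such a cell: the squares overlap. *)
Definition cell (h : R) (t i j : nat) : set R[i] :=
  box (- 2 ^+ t.+2 + i%:R * h) (- 2 ^+ t.+2 + j%:R * h) (2 * h) `&`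
  [set w | 2 ^+ t / 2 <= 1 + Normc.normc w].

Lemma measurable_cell h t i j : measurable (cell h t i j).
Proof.
apply: measurableI; first exact: measurable_box.
rewrite -[X in measurable X]setTI.
apply: measurable_fun_le => //; apply: measurable_funD => //.
exact: measurable_normc.
Qed.

Lemma close_pair_cell (h : R) (z w : R[i]) : 0 < h <= 1 / 2 ->
  Normc.normc (w - z) < h -> exists t i j,
  [/\ i%:R * h < 2 ^+ t.+3, j%:R * h < 2 ^+ t.+3, cell h t i j z & cell h t i j w].
Proof.
move=> /andP[h0 h2] zw.
have [|t /andP[t1 t2]] := @exists_dyadic_shell (1 + Normc.normc z).
  by rewrite lerDl normc_ge0.
have p1 : 1 <= 2 ^+ t :> R by rewrite exprn_ege1//; lra.
have w1 := normc_triangle w z; have w2 := normc_triangle z w.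
rewrite (normc_sym z w) in w2.
have e1 : 2 ^+ t.+1 = 2 * 2 ^+ t :> R by rewrite exprS.
have e2 : 2 ^+ t.+2 = 4 * 2 ^+ t :> R by rewrite !exprS; ring.
have e3 : 2 ^+ t.+3 = 2 * 2 ^+ t.+2 :> R by rewrite exprS.
have bound (a : R) v : `|a| <= Normc.normc v -> Normc.normc v < 2 ^+ t.+2 ->
    - 2 ^+ t.+2 <= a < 2 ^+ t.+2.
  by move=> av; rewrite ler_norml in av; case/andP: av => *; apply/andP; split; lra.
have z4 : Normc.normc z < 2 ^+ t.+2 by lra.
have w4 : Normc.normc w < 2 ^+ t.+2 by lra.
have re : `|complex.Re w - complex.Re z| < h.
  apply: le_lt_trans zw; have := abs_Re_le (w - z).
  by case: (w) (z) => [? ?] [].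
have im : `|complex.Im w - complex.Im z| < h.
  apply: le_lt_trans zw; have := abs_Im_le (w - z).
  by case: (w) (z) => [? ?] [].
have [i [iM [iw iz]]] := exists_common_cell h0 re
  (bound _ _ (abs_Re_le w) w4) (bound _ _ (abs_Re_le z) z4).
have [j [jM [jw jz]]] := exists_common_cell h0 im
  (bound _ _ (abs_Im_le w) w4) (bound _ _ (abs_Im_le z) z4).
by exists t, i, j; split; rewrite ?e3//; split=> //=; lra.
Qed.

Section intensity_bound.
Variables (alpha K : R) (rho : R[i] -> R).
Hypothesis K0 : 0 < K.
Hypothesis rho0 : forall z, 0 < rho z.
Hypothesis rhoK : forall z, rho z ^- 2 <= K * (1 + Normc.normc z) `^ (alpha - 2).
Hypothesis a1 : alpha < 1.

Lemma intensity_ge0 A : (0 <= intensity rho A)%E.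
Proof.
by apply: integral_ge0 => z _; rewrite lee_fin invr_ge0 exprn_ge0// ltW.
Qed.

Lemma intensity_cell_le (h : R) t i j : 0 < h ->
  (intensity rho (cell h t i j) <=
   (4 * K * 2^-1 `^ (alpha - 2) * (2 `^ (alpha - 2)) ^+ t * h ^+ 2)%:E)%E.
Proof.
move=> h0; have t0 : 0 < 2 ^+ t :> R by rewrite exprn_gt0.
have e : (2 ^+ t / 2) `^ (alpha - 2) = 2^-1 `^ (alpha - 2) * (2 `^ (alpha - 2)) ^+ t.
  rewrite mulrC powRM ?exprn_ge0 ?invr_ge0// -[2 ^+ t](powR_mulrn _ (ler0n R 2)).
  by rewrite powRAC powR_mulrn ?powR_ge0.
apply: le_trans (integral_le_cst (K := K * (2 ^+ t / 2) `^ (alpha - 2))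
  _ (measurable_cell h t i j) _) _.
  move=> z [_ /= zt]; rewrite !lee_fin invr_ge0 exprn_ge0 ?(ltW (rho0 _))//=.
  apply: le_trans (rhoK z) _; rewrite ler_wpM2l ?(ltW K0)//.
  by apply: le0_ger_powR; rewrite ?divr_gt0//; have := a1; lra.
rewrite (_ : 4 * K * _ * _ * _ = K * (2 ^+ t / 2) `^ (alpha - 2) * (2 * h) ^+ 2); last first.
  by rewrite e; ring.
rewrite [leRHS]EFinM lee_wpmul2l ?lee_fin 1?mulr_ge0 ?powR_ge0 ?(ltW K0)//.
rewrite -(@lebesgueC_box _ (- 2 ^+ t.+2 + i%:R * h) (- 2 ^+ t.+2 + j%:R * h)); last by lra.
apply: le_measure; rewrite ?inE; [exact: measurable_cell|exact: measurable_box|].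
by move=> z [].
Qed.

Context (d : measure_display) (Omega : measurableType d) (P : probability Omega R)
  (Lambda : Omega -> configuration R[i]).
Hypothesis LambdaP : is_poisson_process P (intensity rho) Lambda.

(** Mesh size; [n.+2] keeps it at most [1 / 2]. *)
Let h n : R := n.+2%:R^-1.
Let h0 n : 0 < h n. Proof. by rewrite invr_gt0. Qed.
Let side n t := (2 ^ t.+3 * n.+2)%N.

Definition crowded_shell n t : set Omega :=
  \big[setU/set0]_(p < side n t * side n t)
    ~` few Lambda (cell (h n) t (p %/ side n t) (p %% side n t)).

Definition crowded n : set Omega := \bigcup_t crowded_shell n t.

Lemma measurable_crowded_shell n t : measurable (crowded_shell n t).
Proof.
apply: bigsetU_measurable => p _; apply: measurableC.
by apply: (measurable_few LambdaP); exact: measurable_cell.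
Qed.

Lemma measurable_crowded n : measurable (crowded n).
Proof. by apply: bigcupT_measurable => t; exact: measurable_crowded_shell. Qed.

Lemma not_separated_crowded n w : ~ is_separated (Lambda w) -> crowded n w.
Proof.
move=> /(not_separated_close_pair (h0 n))[j [k [cj ck jk kj]]].
have [|t [a [b [aM bM jA kA]]]] := close_pair_cell _ kj.
  rewrite h0/= div1r lef_pV2 ?posrE//.
  by rewrite ler_nat.
have sideP (m : nat) : m%:R * h n < 2 ^+ t.+3 -> (m < side n t)%N.
  by rewrite ltr_pdivrMr ?ltr0n// -natrX -natrM ltr_nat.
exists t => //; rewrite /crowded_shell.
rewrite -(bigcup_mkord _ (fun p => ~` few Lambda (cell (h n) t (p %/ side n t) (p %% side n t)))).
have s0 : (0 < side n t)%N by rewrite muln_gt0 expn_gt0.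
exists (a * side n t + b)%N => /=.
  have := sideP _ aM; have := sideP _ bM; move: (side n t) => s; nia.
rewrite divnMDl// divn_small ?sideP// addn0 modnMDl modn_small ?sideP//.
by move=> /(_ j k cj ck jA kA) /eqP; apply/negP.
Qed.

Let q : R := 4 * (2 `^ (alpha - 2)) ^+ 2.
Let C : R := 1024 * (K * 2^-1 `^ (alpha - 2)) ^+ 2.

Let C_ge0 : 0 <= C.
Proof. by apply: mulr_ge0; [exact: ler0n|exact: sqr_ge0]. Qed.

(** There are [(2 ^ (t + 3) / h) ^ 2] cells, each crowded with probability at most
    the square of its intensity; [q] is [2 ^ (2 alpha - 2)]. *)
Lemma probability_crowded_shell_le n t :
  (P (crowded_shell n t) <= (C * h n ^+ 2 * q ^+ t)%:E)%E.
Proof.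
apply: le_trans (Boole_inequality P (A := fun p =>
  ~` few Lambda (cell (h n) t (p %/ side n t) (p %% side n t))) _) _.
  move=> p _; apply: measurableC.
  by apply: (measurable_few LambdaP); exact: measurable_cell.
set v := 4 * K * 2^-1 `^ (alpha - 2) * (2 `^ (alpha - 2)) ^+ t * h n ^+ 2.
apply: (@le_trans _ _ (\sum_(p < side n t * side n t) (v ^+ 2)%:E)%E).
  apply: lee_sum => p _; apply: (probability_many_le LambdaP intensity_ge0).
    exact: measurable_cell.
  exact: intensity_cell_le.
rewrite sumEFin sumr_const card_ord lee_fin -[leLHS]mulr_natr natrM.
have -> : (side n t)%:R = 8 * 2 ^+ t / h n :> R.
  by rewrite natrM natrX invrK !exprS; ring.
have qE : q ^+ t = 2 ^+ t * 2 ^+ t * (2 `^ (alpha - 2) ^+ t) ^+ 2.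
  by rewrite exprAC -!exprMn; congr (_ ^+ _); rewrite /q; ring.
rewrite qE /v /C.
rewrite le_eqVlt; apply/orP; left; apply/eqP.
by field; rewrite gt_eqF.
Qed.

Lemma shell_ratio_lt1 : 0 <= q < 1.
Proof.
rewrite /q mulr_ge0 ?sqr_ge0//=.
have : 2 `^ (alpha - 2) < 2 `^ (-1) :> R.
  rewrite /powR pnatr_eq0/= ltr_expR ltr_pM2r; first by have := a1; lra.
  by rewrite ln_gt0// ltr1n.
rewrite powR_inv1// => b1; have b0 : 0 <= 2 `^ (alpha - 2) :> R by exact: powR_ge0.
nra.
Qed.

Lemma probability_crowded_le n : (P (crowded n) <= (C / (1 - q) * h n ^+ 2)%:E)%E.
Proof.
have /andP[q0 q1] := shell_ratio_lt1.
apply: le_trans (generalized_Boole_inequality P (A := crowded_shell n) _ _) _.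
- exact: measurable_crowded_shell.
- exact: measurable_crowded.
apply: lime_le; first by apply: is_cvg_nneseries.
apply: nearW => m.
apply: (@le_trans _ _ (\sum_(0 <= t < m) (geometric (C * h n ^+ 2) q t)%:E)%E).
  by apply: lee_sum => t _; exact: probability_crowded_shell_le.
rewrite sumEFin lee_fin.
have := @geometric_seriesE _ (C * h n ^+ 2) q.
rewrite lt_eqF// => /(_ isT)/(congr1 (fun f => f m)); rewrite /series/= => ->.
rewrite [leRHS]mulrAC ler_wpM2r ?invr_ge0//; first by lra.
apply: ler_piMr; first by apply: mulr_ge0; [exact: C_ge0|exact: sqr_ge0].
by rewrite gerBl exprn_ge0.
Qed.

Lemma ae_separated : {ae P, forall w, is_separated (Lambda w)}.
Proof.
exists (\bigcap_n crowded n); split.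
- by apply: bigcapT_measurable => n; exact: measurable_crowded.
- have mN : measurable (\bigcap_n crowded n).
    by apply: bigcapT_measurable => n; exact: measurable_crowded.
  set c := C / (1 - q).
  have c0 : 0 <= c.
    have /andP[q0 q1] := shell_ratio_lt1.
    by apply: divr_ge0; [exact: C_ge0|lra].
  apply/eqP; rewrite eq_le measure_ge0 andbT.
  apply/lee_addgt0Pr => e e0; rewrite add0e.
  have [n cn] : exists n : nat, c / e < n%:R.
    by exists (Num.truncn (c / e)).+1; exact: truncnS_gt.
  apply: (@le_trans _ _ (P (crowded n))).
    by apply: le_measure; rewrite ?inE//; [exact: measurable_crowded|move=> w; exact].
  apply: le_trans (probability_crowded_le n) _; rewrite lee_fin -/c.
  apply: (@le_trans _ _ (c * h n)).
    rewrite ler_wpM2l// expr2 ler_piMl ?(ltW (h0 n))//.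
    by rewrite invf_le1 ?ler1n.
  rewrite ler_pdivrMr ?ltr0n// -ler_pdivrMl// mulrC; apply: ltW.
  by apply: lt_le_trans cn _; rewrite ler_nat; lia.
- by move=> w nsep n _; exact: not_separated_crowded.
Qed.

End intensity_bound.
End sparse.

(** * Close pairs for [alpha >= 1] *)

Section dense.
Context {R : realType}.

Local Notation isqrt := PeanoNat.Nat.sqrt.

Lemma isqrt_bounds m : (isqrt m * isqrt m <= m < (isqrt m).+1 * (isqrt m).+1)%N.
Proof. have := PeanoNat.Nat.sqrt_spec m; lia. Qed.

(** With [i = isqrt m], the points [(64 + i, m - i ^ 2)] are distinct integer
    points of modulus at most of order [sqrt m], so that the squares of the
    intensities of these boxes have a divergent sum. The shift [64] keeps them
    where [radius_sqr_le] applies. *)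
Definition sector_box (h : R) (m : nat) : set R[i] :=
  box (64 + (isqrt m)%:R) (m - isqrt m * isqrt m)%:R h.

Lemma measurable_sector_box h m : measurable (sector_box h m).
Proof. exact: measurable_box. Qed.

Lemma nat_interval_inj (a b : nat) (h x : R) : h <= 1 ->
  a%:R <= x < a%:R + h -> b%:R <= x < b%:R + h -> a = b.
Proof.
move=> h1 /andP[ax xa] /andP[bx xb].
have ab : a%:R < b.+1%:R :> R by rewrite -natr1; lra.
have ba : b%:R < a.+1%:R :> R by rewrite -natr1; lra.
by move: ab ba; rewrite !ltr_nat; lia.
Qed.

Lemma trivIset_sector_box h : h <= 1 -> trivIset setT (sector_box h).
Proof.
move=> h1 a b _ _ [z [[/andP[a1 a2] a3] [/andP[b1 b2] b3]]].
have e : isqrt a = isqrt b.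
  by apply: (@nat_interval_inj _ _ h (complex.Re z - 64)) => //; apply/andP; split; lra.
have := nat_interval_inj h1 a3 b3.
have /andP[+ _] := isqrt_bounds a; have /andP[+ _] := isqrt_bounds b.
by rewrite e; lia.
Qed.

Lemma normc_le_ReIm (z : R[i]) :
  Normc.normc z <= `|complex.Re z| + `|complex.Im z|.
Proof.
rewrite -(@ler_pXn2r _ 2)// ?nnegrE ?normc_ge0 ?addr_ge0//.
rewrite sqr_normc sqrrD !real_normK ?num_real// addrAC lerDl.
by rewrite pmulrn_lge0// mulr_ge0.
Qed.

Lemma normc_sector_box h m z : h <= 1 -> sector_box h m z ->
  64 <= Normc.normc z <= 66 * (isqrt m).+1%:R.
Proof.
move=> h1 [/andP[re1 re2] /andP[im1 im2]].
have i0 : 0 <= (isqrt m)%:R :> R by exact: ler0n.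
have j0 : 0 <= (m - isqrt m * isqrt m)%:R :> R by exact: ler0n.
have ji : (m - isqrt m * isqrt m)%:R <= 2 * (isqrt m)%:R :> R.
  by rewrite -natrM ler_nat; have := isqrt_bounds m; lia.
apply/andP; split.
  by apply: le_trans (abs_Re_le z); rewrite ger0_norm; lra.
apply: le_trans (normc_le_ReIm z) _; rewrite -natr1.
by rewrite !ger0_norm; lra.
Qed.

Lemma sector_box_diam h m z w : 0 < h -> sector_box h m z -> sector_box h m w ->
  Normc.normc (w - z) < 2 * h.
Proof.
move=> h0 [/andP[? ?] /andP[? ?]] [/andP[? ?] /andP[? ?]].
apply: le_lt_trans (normc_le_ReIm _) _.
have -> : complex.Re (w - z) = complex.Re w - complex.Re z by case: (w) (z) => [? ?] [].
have -> : complex.Im (w - z) = complex.Im w - complex.Im z by case: (w) (z) => [? ?] [].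
have re : `|complex.Re w - complex.Re z| < h by rewrite ltr_norml; apply/andP; split; lra.
have im : `|complex.Im w - complex.Im z| < h by rewrite ltr_norml; apply/andP; split; lra.
by lra.
Qed.

Lemma radius_sqr_sector_box_le (alpha : R) (rho : R[i] -> R) : 1 <= alpha ->
  is_radius_function (laplacian_measure alpha) rho ->
  exists2 B, 1 <= B & forall h m z, h <= 1 -> sector_box h m z ->
    rho z ^+ 2 <= B * (isqrt m).+1%:R.
Proof.
move=> a1 rhoP; exists (16 * 66); first by lra.
move=> h m z h1 /(normc_sector_box h1)/andP[z1 z2].
by apply: le_trans (radius_sqr_le rhoP a1 z1) _; lra.
Qed.

Section divergence.
Variables (rho : R[i] -> R) (B : R).
Hypothesis rho_gt0 : forall z, 0 < rho z.
Hypothesis B1 : 1 <= B.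
Hypothesis rhoB : forall h m z, h <= 1 -> sector_box h m z ->
  rho z ^+ 2 <= B * (isqrt m).+1%:R.
Context (d : measure_display) (Omega : measurableType d) (P : probability Omega R)
  (Lambda : Omega -> configuration R[i]).
Hypothesis LambdaP : is_poisson_process P (intensity rho) Lambda.

Let B_gt0 : 0 < B. Proof. exact: lt_le_trans B1. Qed.

Let level h m : R := h ^+ 2 / (B * (isqrt m).+1%:R).

Lemma intensity_sector_box_ge h m : 0 < h <= 1 ->
  ((level h m)%:E <= intensity rho (sector_box h m))%E.
Proof.
move=> /andP[h0 h1].
have i0 : 0 < B * (isqrt m).+1%:R by rewrite mulr_gt0 ?ltr0n// B_gt0.
rewrite /level mulrC EFinM -(@lebesgueC_box R (64 + (isqrt m)%:R) (m - isqrt m * isqrt m)%:R);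
  last exact: ltW.
apply: integral_ge_cst; first exact: measurable_sector_box.
  by rewrite invr_ge0 ltW.
move=> z /(rhoB h1) zB; rewrite lee_fin.
by rewrite lef_pV2 ?posrE// exprn_gt0// rho_gt0.
Qed.

Let c h : R := h ^+ 4 / (18 * B ^+ 2).

Let c_gt0 h : 0 < h -> 0 < c h.
Proof.
by move=> h0; rewrite divr_gt0 ?exprn_gt0// mulr_gt0 ?exprn_gt0// B_gt0.
Qed.

(** This is where the harmonic series comes from: [(isqrt m + 1) ^ 2] is at most
    [2 (m + 1)]. *)
Lemma level_sqr_ge h m : 0 < h -> c h * harmonic m <= (level h m / 3) ^+ 2.
Proof.
move=> h0; rewrite /=.
set s : R := (isqrt m).+1%:R.
have s0 : 0 < s by rewrite ltr0n.
have sm : s ^+ 2 <= 2 * m.+1%:R.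
  rewrite /s -natrX -natrM ler_nat; have /andP[+ _] := isqrt_bounds m; nia.
have m0 : 0 < m.+1%:R :> R by rewrite ltr0n.
have -> : (level h m / 3) ^+ 2 = c h * (2 / s ^+ 2).
  rewrite /level /c -/s; have := B_gt0 => B0.
  by field; rewrite !gt_eqF.
rewrite ler_wpM2l ?(ltW (c_gt0 h0))//.
by rewrite ler_pdivlMr ?exprn_gt0// mulrC ler_pdivrMr.
Qed.

Lemma probability_few_sector_box_le h m : 0 < h <= 1 ->
  (P (few Lambda (sector_box h m)) <= (expR (- (c h * harmonic m)))%:E)%E.
Proof.
move=> h01; have /andP[h0 h1] := h01.
apply: le_trans (probability_few_le LambdaP (intensity_ge0 rho_gt0) _ (l := level h m) _ _) _.
- exact: measurable_sector_box.
- have s1 : 1 <= (isqrt m).+1%:R :> R by rewrite ler1n.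
  have Bs : 1 <= B * (isqrt m).+1%:R by rewrite mulr_ege1// B1.
  apply/andP; split; first by rewrite divr_ge0 ?sqr_ge0//; lra.
  by rewrite ler_pdivrMr; [nra|lra].
- exact: intensity_sector_box_ge.
rewrite lee_fin; apply: le_trans (expR_ge1Dx _).
by rewrite lerD2l lerN2 level_sqr_ge.
Qed.

Lemma probability_bigcap_sector_le h N : 0 < h <= 1 ->
  (P (\bigcap_(m : 'I_N) few Lambda (sector_box h m)) <=
   (expR (- (c h * series harmonic N)))%:E)%E.
Proof.
move=> h01; have /andP[h0 h1] := h01.
rewrite (probability_bigcap_few LambdaP (A := fun m : 'I_N => sector_box h m)); last 2 first.
- by move=> m; exact: measurable_sector_box.
- by move=> i j _ _ ij; apply/val_inj/(trivIset_sector_box h1).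
rewrite /series/= big_mkord mulr_sumr -sumrN expR_sum.
have [] : (0 <= \prod_(m < N) P (few Lambda (sector_box h m)) /\
  \prod_(m < N) P (few Lambda (sector_box h m)) <=
  (\prod_(m < N) expR (- (c h * harmonic m)))%:E)%E; last by [].
apply: (big_ind2 (fun x y => 0 <= x /\ x <= y%:E)%E).
- by [].
- move=> x1 x2 y1 y2 [x10 x12] [y10 y12]; split; first exact: mule_ge0.
  by rewrite EFinM; apply: lee_pmul.
- by move=> m _; split; [exact: measure_ge0|exact: probability_few_sector_box_le].
Qed.

(** Along the harmonic series the bound of [probability_bigcap_sector_le] tends to
    [0]; otherwise [- ln (P Z) / c h] would bound the partial sums. *)
Lemma negligible_few_sector h : 0 < h <= 1 ->
  P.-negligible (\bigcap_m few Lambda (sector_box h m)).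
Proof.
move=> h01; have /andP[h0 h1] := h01.
set Z := \bigcap_m _.
have mZ : measurable Z.
  apply: bigcapT_measurable => m; apply: (measurable_few LambdaP).
  exact: measurable_sector_box.
apply/negligibleP => //.
have Zle N : (P Z <= (expR (- (c h * series harmonic N)))%:E)%E.
  apply: le_trans (probability_bigcap_sector_le N h01).
  apply: le_measure; rewrite ?inE//; last by move=> w Zw m _; exact: Zw.
  apply: fin_bigcap_measurable => // m _.
  by apply: (measurable_few LambdaP); exact: measurable_sector_box.
have c0 := c_gt0 h0.
have Zfin : P Z \is a fin_num by exact: fin_num_measure.
apply/eqP; rewrite eq_le measure_ge0 andbT leNgt; apply/negP => Z0.
apply: (@dvg_harmonic R); apply: nondecreasing_is_cvgn.
  by apply: nondecreasing_series => m _; rewrite harmonic_ge0.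
exists (- ln (fine (P Z)) / c h) => _ [N _ <-].
rewrite ler_pdivlMr// mulrC lerNr -ler_expR lnK ?posrE ?fine_gt0 ?Z0//=.
  by rewrite -lee_fin fineK.
by rewrite ltey_eq Zfin.
Qed.

Lemma separated_few_sector w : is_separated (Lambda w) ->
  exists n : nat, forall m, few Lambda (sector_box n.+1%:R^-1 m) w.
Proof.
set S := (X in (0 < ereal_inf X)%E -> _) => S0.
have [e e0 eS] : exists2 e : R, 0 < e & (e%:E <= ereal_inf S)%E.
  move: S0; rewrite -/S; case: (ereal_inf S) => [r| |]//= r0; first by exists r.
  by exists 1; rewrite ?leey.
exists (Num.truncn (2 / e)) => m j k cj ck mj mk; apply: contrapT => /eqP jk.
have h0 : 0 < (Num.truncn (2 / e)).+1%:R :> R by rewrite ltr0n.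
have := sector_box_diam _ mj mk; rewrite invr_gt0 => /(_ h0).
have : (e%:E <= (Normc.normc (atom (Lambda w) k - atom (Lambda w) j))%:E)%E.
  by apply: le_trans eS _; apply: ereal_inf_lbound; exists j, k.
rewrite lee_fin => le1 lt1; have := le_lt_trans le1 lt1.
rewrite ltr_pdivlMr// mulrC -ltr_pdivlMr// ltNge => /negP; apply.
exact/ltW/truncnS_gt.
Qed.

Lemma negligible_separated :
  P.-negligible [set w | is_separated (Lambda w)].
Proof.
apply: (@negligibleS _ _ _ _
  (\bigcup_n \bigcap_m few Lambda (sector_box n.+1%:R^-1 m))).
  by move=> w /separated_few_sector[n nP]; exists n.
apply: negligible_bigcup => n; apply: negligible_few_sector.
by rewrite invr_gt0 ltr0n/= invf_le1 ?ler1n.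
Qed.

Lemma not_ae_separated : ~ {ae P, forall w, is_separated (Lambda w)}.
Proof.
move=> aes.
have negT : P.-negligible [set: Omega].
  rewrite -(setUv [set w | is_separated (Lambda w)]).
  by apply: negligibleU; [exact: negligible_separated|exact: aes].
have /eqP : P [set: Omega] = 0%E := measure_negligible measurableT negT.
by rewrite probability_setT onee_eq0.
Qed.

End divergence.
End dense.

Unset Implicit Arguments.
Set Strict Implicit.
Set Printing Implicit Defensive.

Theorem mainTheorem5 (R : realType) (alpha : R) (alpha_gt0 : 0 < alpha)
    (rho : R[i] -> R)
    (rhoP : is_radius_function (laplacian_measure alpha) rho)
    (d : measure_display) (Omega : measurableType d) (P : probability Omega R)
    (Lambda : Omega -> configuration R[i])
    (LambdaP : is_poisson_process P (intensity rho) Lambda) :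
  {ae P, forall w, is_separated (Lambda w)} <-> alpha < 1.
Proof.
have rho_gt0 z : 0 < rho z by have [] := rhoP z.
split.
- move=> aes; rewrite ltNge; apply/negP => a1.
  have [B B1 rhoB] := radius_sqr_sector_box_le a1 rhoP.
  exact: (not_ae_separated rho_gt0 B1 rhoB LambdaP).
- move=> a1; have [|K K0 rhoK] := inv_radius_sqr_le rhoP.
    by rewrite alpha_gt0.
  exact: (ae_separated K0 rho_gt0 rhoK a1 LambdaP).
Qed.
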